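(* For every patterned fixed point $p_\ast\in\{(1,-1,-1),(-1,1,-1),(-1,-1,1)\}$ of $T$, the basin $$\mathcal B(p_\ast)=\{p\in\mathcal E_3^{\mathrm{nd}}:T^k(p)\to p_\ast\text{ as }k\to\infty\}$$ is relatively open in $\mathcal E_3^{\mathrm{nd}}$ and is therefore Lebesgue measurable. For every $\sigma\in S_3$, $$\sigma\cdot\mathcal B(p_\ast)=\mathcal B(\sigma\cdot p_\ast).$$ The three patterned basins have equal Lebesgue measure. Moreover, $$\lambda_3(\mathcal B(p_\ast))=\tfrac13\lambda_3(\mathcal E_3)$$ for each patterned fixed point $p_\ast$.
   Context: For nonconstant $x,y\in\mathbb R^3$, with means $\bar x,\bar y$, the Pearson correlation is $\operatorname{corr}(x,y)=\frac{\sum_k(x_k-\bar x)(y_k-\bar y)}{\sqrt{\sum_k(x_k-\bar x)^2\sum_k(y_k-\bar y)^2}}$. For a real $3\times3$ matrix $A$ with nonconstant rows $r_1,r_2,r_3$, the correlation map is $[C(A)]_{ij}=\operatorname{corr}(r_i,r_j)$. For $p=(a,b,c)\in\mathbb R^3$ let $A(p)=A(a,b,c)=\begin{pmatrix} 1 & a & b \\ a & 1 & c \\ b & c & 1 \end{pmatrix}$. Let $\mathcal E_3=\{(a,b,c)\in[-1,1]^3:1+2abc-a^2-b^2-c^2\ge0\}$, and let $\mathcal E_3^{\mathrm{nd}}$ be the set of $p\in\mathcal E_3$ such that all rows of $A(p)$ are nonconstant; one has $\mathcal E_3^{\mathrm{nd}}=\mathcal E_3\setminus\{(1,1,1)\}$.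 The map $T:\mathcal E_3^{\mathrm{nd}}\to\mathcal E_3^{\mathrm{nd}}$ is defined by $A(T(p))=C(A(p))$, and $T^k$ is its $k$-th iterate. $\lambda_3$ is three-dimensional Lebesgue measure in the coordinates $(a,b,c)$. The symmetric group $S_3$ acts on $\mathcal E_3$ by $A(\sigma\cdot p)=R_\sigma A(p)R_\sigma^T$, where $R_\sigma$ is the $3\times3$ permutation matrix of $\sigma$ (this permutes the three coordinates of $p$), and on subsets by $\sigma\cdot E=\{\sigma\cdot p:p\in E\}$. *)

(* Defs.v *)
From mathcomp Require Import all_boot all_order all_algebra all_fingroup.
From mathcomp Require Import all_classical all_reals all_analysis.

Set Implicit Arguments.
Unset Strict Implicit.
Unset Printing Implicit Defensive.

Import Order.TTheory GRing.Theory Num.Theory.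
Import numFieldNormedType.Exports.

Local Open Scope classical_set_scope.
Local Open Scope ring_scope.

Section Correlation.
Context {R : realType}.

Definition nonconstant (x : 'rV[R]_3) : Prop :=
  exists k l, x ord0 k != x ord0 l.

Definition mean (x : 'rV[R]_3) : R := (\sum_k x ord0 k) / 3.

(* As inverses of zero are zero, this is 0 when x or y is constant. *)
Definition corr (x y : 'rV[R]_3) : R :=
  (\sum_k (x ord0 k - mean x) * (y ord0 k - mean y)) /
  Num.sqrt ((\sum_k (x ord0 k - mean x) ^+ 2) *
            (\sum_k (y ord0 k - mean y) ^+ 2)).

Definition corr_map (M : 'M[R]_3) : 'M[R]_3 :=
  \matrix_(i, j) corr (row i M) (row j M).

End Correlation.

Section Elliptope.
Context {R : realType}.

Local Notation i0 := (inord 0 : 'I_3).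
Local Notation i1 := (inord 1 : 'I_3).
Local Notation i2 := (inord 2 : 'I_3).

Definition Amx (p : R * R * R) : 'M[R]_3 :=
  let: (a, b, c) := p in
  \matrix_(i, j) nth 0 (nth [::] [:: [:: 1; a; b];
                                     [:: a; 1; c];
                                     [:: b; c; 1]] i) j.

(* Inverse of Amx on the symmetric matrices with unit diagonal, see Amx_offdiag. *)
Definition offdiag (M : 'M[R]_3) : R * R * R := (M i0 i1, M i0 i2, M i1 i2).

Definition E3 : set (R * R * R) :=
  [set p | let: (a, b, c) := p in
    [/\ -1 <= a <= 1, -1 <= b <= 1, -1 <= c <= 1 &
        0 <= 1 + 2 * a * b * c - a ^+ 2 - b ^+ 2 - c ^+ 2]].

Definition E3nd : set (R * R * R) :=
  [set p | E3 p /\ forall i, nonconstant (row i (Amx p))].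

(* Total function; only its restriction to E3nd is meaningful, see Amx_Tmap. *)
Definition Tmap (p : R * R * R) : R * R * R := offdiag (corr_map (Amx p)).

Definition basin (q : R * R * R) : set (R * R * R) :=
  [set p | E3nd p /\ (iter k Tmap p @[k --> \oo] --> q)].

Definition patterned : set (R * R * R) :=
  [set p | [\/ p = (1, -1, -1), p = (-1, 1, -1) | p = (-1, -1, 1)]].

(* perm_mx s has a 1 at (i, s i), so s^-1 gives the matrix sending the column
   basis vector e_j to e_(s j); with it, sact is a left action for the
   composition of functions. *)
Definition sact (s : 'S_3) (p : R * R * R) : R * R * R :=
  let Rs : 'M[R]_3 := perm_mx s^-1 in offdiag (Rs *m Amx p *m Rs^T).

(* A measure on the product sigma-algebra of R * R * R, i.e. on the Borel sets
   of R^3; its value on other sets is meaningless. *)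
Definition lambda3 : set (R * R * R) -> \bar R :=
  ((lebesgue_measure \x lebesgue_measure) \x lebesgue_measure)%E.

Definition relatively_open (D B : set (R * R * R)) : Prop :=
  exists2 U, open U & B = D `&` U.

Let case3 (P : 'I_3 -> Prop) : P i0 -> P i1 -> P i2 -> forall i, P i.
Proof.
move=> P0 P1 P2 [[|[|[|//]]] H].
- by rewrite (_ : Ordinal H = i0)//; apply/val_inj; rewrite /= inordK.
- by rewrite (_ : Ordinal H = i1)//; apply/val_inj; rewrite /= inordK.
- by rewrite (_ : Ordinal H = i2)//; apply/val_inj; rewrite /= inordK.
Qed.

Lemma Amx_offdiag (M : 'M[R]_3) :
  M^T = M -> (forall i, M i i = 1) -> Amx (offdiag M) = M.
Proof.
move=> symM diagM; have sym i j : M i j = M j i by rewrite -[in LHS]symM mxE.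
by apply/matrixP; apply: case3; apply: case3;
   rewrite mxE !inordK //= ?diagM // sym.
Qed.

Lemma corrC (x y : 'rV[R]_3) : corr x y = corr y x.
Proof.
rewrite /corr; congr (_ / Num.sqrt _); last exact: mulrC.
by apply: eq_bigr => k _; rewrite mulrC.
Qed.

Lemma corrxx (x : 'rV[R]_3) : nonconstant x -> corr x x = 1.
Proof.
move=> [k [l xkl]]; rewrite /corr; set S := \sum_k (x ord0 k - mean x) ^+ 2.
have S0 : 0 <= S by apply: sumr_ge0 => i _; exact: sqr_ge0.
rewrite -expr2 sqrtr_sqr ger0_norm// -[X in X / _]/S mulfV//.
apply: contra xkl; rewrite psumr_eq0; last by move=> i _; exact: sqr_ge0.
move=> /allP h.
have e i : x ord0 i = mean x.
  by apply/eqP; rewrite -subr_eq0 -sqrf_eq0; apply: h; rewrite mem_index_enum.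
by rewrite !e.
Qed.

Lemma Amx_Tmap (p : R * R * R) : (forall i, nonconstant (row i (Amx p))) ->
  Amx (Tmap p) = corr_map (Amx p).
Proof.
move=> ncp; apply: Amx_offdiag => [|i]; last by rewrite mxE corrxx.
by apply/matrixP => i j; rewrite !mxE corrC.
Qed.

Lemma Amx_sact (s : 'S_3) (p : R * R * R) :
  Amx (sact s p) = perm_mx s^-1 *m Amx p *m (perm_mx s^-1)^T.
Proof.
have symp : (Amx p)^T = Amx p.
  case: p => [[a b] c]; apply/matrixP.
  by apply: case3; apply: case3; rewrite !mxE !inordK.
apply: Amx_offdiag => [|i].
  by rewrite !trmx_mul trmxK symp mulmxA.
rewrite tr_perm_mx -row_permE -col_permE !mxE; case: p {symp} => [[a b] c].
by move: (s^-1%g i); apply: case3; rewrite mxE !inordK.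
Qed.

End Elliptope.

(* Main.v *)
Require Import Defs.
From mathcomp Require Import all_boot all_order all_algebra all_fingroup.
From mathcomp Require Import all_classical all_reals all_analysis.
From mathcomp Require Import measurable_realfun.
From mathcomp Require Import ring lra.

Set Implicit Arguments.
Unset Strict Implicit.
Unset Printing Implicit Defensive.

Import Order.TTheory GRing.Theory Num.Theory.
Import numFieldNormedType.Exports.

Local Open Scope classical_set_scope.
Local Open Scope ring_scope.

(** In the coordinates (x, y, z) = (1 - a, 1 - b, 1 - c) the rows of A(p) are
    (1, 1, 1) minus (0, x, y), (x, 0, z) and (y, z, 0), so one step of the map
    depends on (x : y : z) only, and it commutes with the permutations of the
    coordinates.  The whole proof rests on two facts about nonnegative triples
    that satisfy the elliptope inequality.

    - The step preserves the order of the coordinates ([rcorr_antitone]).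
    - If x <= y <= z then the ratio x / y of the two smallest coordinates
      drops, by at least the factor 1 + (1 - x / y) / 7 ([rcorr_ratio]).

    Hence, if x is strictly the smallest coordinate, the ratios of x to the
    other two decay geometrically, and the elliptope inequality
    (z - y)^2 <= 2 x (y + z) then forces the other two coordinates to become
    equal, so their new values tend to 2 ([orbit_cvg]): the orbit tends to
    (1, -1, -1).  Conversely a weak inequality between two coordinates
    persists along the orbit and in its limit.  So the basin of a patterned
    point q consists exactly of the points p whose coordinates satisfy
    strictly every strict inequality between the coordinates of q
    ([basinE]): one of a, b, c is strictly larger than the two others.

    This description is visibly relatively open, Borel and compatible with
    permutations of the coordinates.  The permutations preserve the measure,
    so the three basins have the same measure; they are disjoint and cover the
    elliptope up to ties between two coordinates, which form a null set.

    The ratio bound comes from comparing the step at (x, y, z) with the step at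
    (y, y, z), where the two smallest coordinates agree.  Passing from
    (y, y, z) to (x, y, z) multiplies the new smallest coordinate by at most
    x / y ([rcorr_lowest_chord]) and multiplies the new middle one by at least
    1 + (1 - x / y) / 7 ([rcorr_middle_gap]). *)

Section Dynamics.
Context {R : realType}.
Implicit Types (x y z t : R) (p q : R * R * R).

(** * The correlation of two rows as a function of x, y, z *)

(** Sending the three basis vectors to the cube roots of unity 1, w, w^2
    identifies the centred row (0, x, y) with x w + y w^2, up to the factor
    2 / 3 on squared lengths; [rvar x y] is its squared modulus. *)
Definition rvar x y : R := x ^+ 2 - x * y + y ^+ 2.

(** The inner product of (0, x, y) and (x, 0, z) after centring, in the same
    normalisation as [rvar]. *)
Definition rcov x y z : R := y * z - x * (x + y + z) / 2.

Definition rcorr x y z : R := rcov x y z / Num.sqrt (rvar x y * rvar x z).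

Lemma rvarC x y : rvar x y = rvar y x.
Proof. by rewrite /rvar; ring. Qed.

Lemma rcorrC x y z : rcorr x y z = rcorr x z y.
Proof.
rewrite /rcorr mulrC [in RHS]mulrC [rvar x z * _]mulrC; congr (_ * _).
by rewrite /rcov; field.
Qed.

Lemma rvar_gt0 x y : 0 < y -> 0 < rvar x y.
Proof. by move=> y0; rewrite /rvar; have := sqr_ge0 (x - y / 2); nra. Qed.

(** The product of the squared moduli of two complex numbers is the square of
    their inner product plus the square of their determinant, which is
    sqrt 3 / 2 times x (y + z - x) up to sign. *)
Lemma rcov_sqr x y z :
  rcov x y z ^+ 2 = rvar x y * rvar x z - 3 / 4 * (x * (y + z - x)) ^+ 2.
Proof. by rewrite /rcov /rvar; field. Qed.

Lemma normr_rcov_le x y z : `|rcov x y z| <= Num.sqrt (rvar x y * rvar x z).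
Proof.
rewrite -sqrtr_sqr ler_wsqrtr// rcov_sqr gerBl.
by rewrite mulr_ge0 ?sqr_ge0//; lra.
Qed.

Lemma normr_rcorr_le1 x y z : `|rcorr x y z| <= 1.
Proof.
have := normr_rcov_le x y z; rewrite /rcorr normrM normfV.
have := sqrtr_ge0 (rvar x y * rvar x z); set Q := Num.sqrt _ => Q0 h.
rewrite (ger0_norm Q0); have [->|Qn] := eqVneq Q 0; first by rewrite invr0 mulr0.
by rewrite ler_pdivrMr ?mul1r// lt_neqAle eq_sym Qn.
Qed.

Lemma rcorr_scale l x y z : 0 < l -> rcorr (l * x) (l * y) (l * z) = rcorr x y z.
Proof.
move=> l0; rewrite /rcorr; have -> : rvar (l * x) (l * y) * rvar (l * x) (l * z) =
  (l ^+ 2) ^+ 2 * (rvar x y * rvar x z) by rewrite /rvar; ring.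
rewrite sqrtrM ?sqr_ge0// sqrtr_sqr ger0_norm ?sqr_ge0//.
have -> : rcov (l * x) (l * y) (l * z) = l ^+ 2 * rcov x y z by rewrite /rcov; ring.
by rewrite -mulf_div divff ?mul1r// expf_neq0// gt_eqF.
Qed.

Lemma rcorr_div l x y z : 0 < l -> rcorr (x / l) (y / l) (z / l) = rcorr x y z.
Proof. by move=> l0; rewrite ![_ / l]mulrC rcorr_scale// invr_gt0. Qed.

(** The new coordinate of the larger of two entries stays larger when the third
    entry x is the smallest.  Here [rcov z x y] is nonpositive, so only the case
    where both covariances are negative is in doubt; by [rcov_sqr] the
    comparison of their squares reduces to one between the determinant terms. *)
Lemma rcorr_le_top x y z : 0 <= x -> x <= y -> y <= z -> 0 < y ->
  rcorr z x y <= rcorr y x z.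
Proof.
move=> x0 xy yz y0; have z0 : 0 < z by lra.
have p0 : 0 < rvar y x by rewrite rvarC rvar_gt0.
have q0 : 0 < rvar z x by rewrite rvarC rvar_gt0.
have r0 : 0 < rvar y z by rewrite rvar_gt0.
rewrite /rcorr (rvarC z y) !sqrtrM ?(ltW p0) ?(ltW q0)//.
have sqr_le : (z * (x + y - z)) ^+ 2 * rvar y x <= (y * (x + z - y)) ^+ 2 * rvar z x.
  have cross : 0 <= (x ^+ 2 + (z - y) ^+ 2) * (y * z - x * (y + z)) +
      2 * (y ^+ 2 * rvar z x + z ^+ 2 * rvar y x).
    have e1 : - (x ^+ 2) <= y * z - x * (y + z) by nra.
    have e2 : 3 / 4 * z ^+ 2 <= rvar z x.
      by rewrite /rvar; have := sqr_ge0 (x - z / 2); nra.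
    have e3 : 3 / 4 * y ^+ 2 <= rvar y x.
      by rewrite /rvar; have := sqr_ge0 (x - y / 2); nra.
    have e4 : y ^+ 2 * (3 / 4 * z ^+ 2) <= y ^+ 2 * rvar z x.
      by rewrite ler_wpM2l ?sqr_ge0.
    have e5 : z ^+ 2 * (3 / 4 * y ^+ 2) <= z ^+ 2 * rvar y x.
      by rewrite ler_wpM2l ?sqr_ge0.
    have e6 : (x ^+ 2 + (z - y) ^+ 2) * - (x ^+ 2) <=
        (x ^+ 2 + (z - y) ^+ 2) * (y * z - x * (y + z)).
      by rewrite ler_wpM2l// addr_ge0 ?sqr_ge0.
    have e7 : (x ^+ 2 + (z - y) ^+ 2) * x ^+ 2 <= 2 * z ^+ 2 * y ^+ 2.
      by apply: ler_pM; rewrite ?addr_ge0 ?sqr_ge0//; nra.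
    nra.
  have e : (y * (x + z - y)) ^+ 2 * rvar z x - (z * (x + y - z)) ^+ 2 * rvar y x =
    x * (z - y) * ((x ^+ 2 + (z - y) ^+ 2) * (y * z - x * (y + z)) +
      2 * (y ^+ 2 * rvar z x + z ^+ 2 * rvar y x)) by rewrite /rvar; ring.
  by rewrite -subr_ge0 e mulr_ge0// mulr_ge0//; lra.
have := rcov_sqr z x y; have := rcov_sqr y x z; rewrite (rvarC z y).
have Nc0 : rcov z x y <= 0 by rewrite /rcov; nra.
move: Nc0 sqr_le; set Nc := rcov z x y; set Nb := rcov y x z => Nc0 sqr_le Nb2 Nc2.
set P := Num.sqrt (rvar y x); set W := Num.sqrt (rvar y z).
set Q := Num.sqrt (rvar z x).
have P0 : 0 < P by rewrite sqrtr_gt0.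
have W0 : 0 < W by rewrite sqrtr_gt0.
have Q0 : 0 < Q by rewrite sqrtr_gt0.
have P2 : P ^+ 2 = rvar y x by rewrite sqr_sqrtr// ltW.
have Q2 : Q ^+ 2 = rvar z x by rewrite sqr_sqrtr// ltW.
rewrite ler_pdivrMr ?mulr_gt0//.
have -> : Nb / (P * W) * (Q * W) = Nb * Q / P by field; rewrite !gt_eqF.
rewrite ler_pdivlMr//; have [Nb0|Nb0] := leP 0 Nb.
  by apply: (@le_trans _ _ 0); rewrite ?mulr_ge0 ?mulr_le0_ge0// ?ltW// pmulr_lle0.
suff : - Nb * Q <= - Nc * P by lra.
rewrite -(@ler_pXn2r _ 2) ?nnegrE ?mulr_ge0 ?oppr_ge0//
  ?(ltW Nb0) ?(ltW Q0) ?(ltW P0)//.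
rewrite !exprMn P2 Q2 !sqrrN Nb2 Nc2; nra.
Qed.

(** With P the modulus of the row (0, 1, x), which is at most 1, and m the value
    of [rcov 1 1 z], the gain m P - rcov 1 x z is at least (1 - x) / 2: bound P
    from below by (1 + x) / 2 when m is nonnegative and from above by 1 when it
    is not.  With W the modulus of the row (0, 1, z), the quantity to be amplified
    is W - m, and z <= 5 keeps it below 7 / 2, whence the constant 7. *)
Lemma rcorr_middle_gap1 x z : 0 <= x <= 1 -> 1 <= z <= 5 ->
  (1 + (1 - x) / 7) * (1 - rcorr 1 1 z) <= 1 - rcorr 1 x z.
Proof.
move=> /andP[x0 x1] /andP[z1 z5]; rewrite /rcorr.
have -> : rvar 1 1 = 1 :> R by rewrite /rvar; ring.
have p0 : 0 < rvar 1 x by rewrite rvarC rvar_gt0.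
have r0 : 0 < rvar 1 z by rewrite rvar_gt0//; lra.
rewrite mul1r sqrtrM ?(ltW p0)//.
set P := Num.sqrt (rvar 1 x); set W := Num.sqrt (rvar 1 z).
have P0 : 0 < P by rewrite sqrtr_gt0.
have W0 : 0 < W by rewrite sqrtr_gt0.
have P2 : P ^+ 2 = rvar 1 x by rewrite sqr_sqrtr// ltW.
have W2 : W ^+ 2 = rvar 1 z by rewrite sqr_sqrtr// ltW.
have -> : rcov 1 1 z = z / 2 - 1 by rewrite /rcov; field.
have Pl : P <= 1 by move: P2; rewrite /rvar; nra.
have Pg : (1 + x) / 2 <= P by move: P2; rewrite /rvar; have := sqr_ge0 (1 - x); nra.
have Wl : W <= z by move: W2; rewrite /rvar; nra.
have key : (1 - x) / 2 <= (z / 2 - 1) * P - rcov 1 x z.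
  rewrite /rcov; have [z2|z2] := leP 2 z.
    have : (z / 2 - 1) * ((1 + x) / 2) <= (z / 2 - 1) * P by rewrite ler_wpM2l//; lra.
    nra.
  have : (z / 2 - 1) * 1 <= (z / 2 - 1) * P by rewrite ler_wnM2l//; lra.
  nra.
have PW : 0 < P * W by rewrite mulr_gt0.
have -> : 1 - rcov 1 x z / (P * W) = (P * W - rcov 1 x z) / (P * W).
  by field; rewrite !gt_eqF.
have -> : 1 - (z / 2 - 1) / W = (W - (z / 2 - 1)) / W by field; rewrite gt_eqF.
rewrite ler_pdivlMr//.
have -> : (1 + (1 - x) / 7) * ((W - (z / 2 - 1)) / W) * (P * W) =
  (1 + (1 - x) / 7) * (W - (z / 2 - 1)) * P by field; rewrite gt_eqF.
set m := z / 2 - 1 in key *; set N := rcov 1 x z in key *.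
have Wm : 0 <= W - m.
  by rewrite /m; move: W2; rewrite /rvar; nra.
have Wm7 : W - m <= 7 / 2 by rewrite /m; lra.
suff : (1 - x) / 7 * (W - m) * P <= (1 - x) / 2 by lra.
have WP : (W - m) * P <= 7 / 2 by nra.
nra.
Qed.

(** This is the sign of the derivative in [rcorr_lowest_chord1].  The centred
    rows (0, x, 1) and (x, 0, z) make an angle g + h with
    tan g = sqrt 3 x / (2 - x) and tan h = sqrt 3 x / (2 z - x), and the bound is
    the convexity of the tangent, tan ((g + h) / 2) <= (tan g + tan h) / 2,
    combined with rvar x 1 <= 2 - x and rvar x z <= z (2 z - x). *)
Lemma rcorr_slope_ge0 x z : 0 < x <= 1 -> 1 <= z ->
  rvar x 1 * rvar x z * (Num.sqrt (rvar x 1 * rvar x z) - rcov x 1 z) <=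
    3 / 4 * x ^+ 2 * (1 + z - x) * (rvar x z + z * rvar x 1).
Proof.
move=> /andP[x0 x1] z1; set p := rvar x 1; set q := rvar x z.
set Q := Num.sqrt (p * q); set N := rcov x 1 z.
have p0 : 0 < p by rewrite rvar_gt0//.
have q0 : 0 < q by rewrite rvar_gt0//; lra.
have pq0 : 0 < p * q by rewrite mulr_gt0.
have Q0 : 0 < Q by rewrite sqrtr_gt0.
have Q2 : Q ^+ 2 = p * q by rewrite sqr_sqrtr// ltW.
have NE : N = (1 - x / 2) * (z - x / 2) - 3 / 4 * x ^+ 2 by rewrite /N /rcov; field.
(* cos (g - h) <= 1 *)
have cs : (1 - x / 2) * (z - x / 2) + 3 / 4 * x ^+ 2 <= Q.
  rewrite -(@ler_pXn2r _ 2) ?nnegrE ?(ltW Q0)//; last by nra.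
  rewrite Q2 -subr_ge0.
  have -> : p * q - ((1 - x / 2) * (z - x / 2) + 3 / 4 * x ^+ 2) ^+ 2 =
    3 / 4 * (x * (z - 1)) ^+ 2 by rewrite /p /q /rvar; field.
  by rewrite mulr_ge0 ?sqr_ge0//; lra.
have QN : (2 - x) * (2 * z - x) / 2 <= Q + N by rewrite NE; lra.
have QNM : (Q - N) * (Q + N) = 3 / 4 * (x * (1 + z - x)) ^+ 2.
  by have := rcov_sqr x 1 z; rewrite -/p -/q -/N; nra.
have pl : p <= 2 - x by rewrite /p /rvar; nra.
have ql : q <= z * (2 * z - x) by rewrite /q /rvar; nra.
have QNp : 0 < Q + N by apply: lt_le_trans QN; rewrite divr_gt0 ?mulr_gt0//; lra.
rewrite -(ler_pM2r QNp) -[leLHS]mulrA QNM.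
have -> : 3 / 4 * x ^+ 2 * (1 + z - x) * (q + z * p) * (Q + N) =
  3 / 4 * x ^+ 2 * (1 + z - x) * ((q + z * p) * (Q + N)) by ring.
have -> : p * q * (3 / 4 * (x * (1 + z - x)) ^+ 2) =
  3 / 4 * x ^+ 2 * (1 + z - x) * (p * q * (1 + z - x)) by field.
apply: ler_wpM2l; first by rewrite !mulr_ge0 ?sqr_ge0//; lra.
have e1 : (q + z * p) * ((2 - x) * (2 * z - x) / 2) <= (q + z * p) * (Q + N).
  by rewrite ler_wpM2l// addr_ge0 ?mulr_ge0//; lra.
apply: le_trans e1.
have e2 : q * (2 * z - x) * p <= q * (2 * z - x) * (2 - x).
  by rewrite ler_wpM2l// mulr_ge0//; lra.
have e3 : p * (2 - x) * q <= p * (2 - x) * (z * (2 * z - x)).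
  by rewrite ler_wpM2l// mulr_ge0//; lra.
lra.
Qed.

Lemma is_derive_rcov z t :
  is_derive t 1 (fun t => rcov t 1 z) (- (1 + z) / 2 - t).
Proof.
rewrite /rcov; apply: is_derive_eq.
by rewrite /GRing.scale /=; field.
Qed.

Lemma is_derive_rvar y t : is_derive t 1 (fun t => rvar t y) (2 * t - y).
Proof.
rewrite /rvar; apply: is_derive_eq.
by rewrite /GRing.scale /=; ring.
Qed.

Lemma is_derive_one_sub_div (N Q : R -> R) t dN dQ :
  is_derive t 1 N dN -> is_derive t 1 Q dQ -> Q t != 0 -> t != 0 ->
  is_derive t 1 (fun s => (1 - N s / Q s) / s)
    ((t * (N t * dQ - dN * Q t) - Q t * (Q t - N t)) / (t * Q t) ^+ 2).
Proof.
move=> hN hQ Q0 t0.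
have hQV := is_deriveV Q0 hQ.
have htV := is_deriveV t0 (is_derive_id t 1).
apply: is_derive_eq; rewrite /GRing.scale /=.
by move: (Q t) (N t) Q0 => q n q0; field; rewrite q0 t0.
Qed.

(** The quotient (1 - rcorr t 1 z) / t is nondecreasing in t on ]0, 1]: the
    graph of the new coordinate stays below its chord from the origin. *)
Lemma rcorr_lowest_chord1 x z : 0 <= x <= 1 -> 1 <= z ->
  1 - rcorr x 1 z <= x * (1 - rcorr 1 1 z).
Proof.
move=> /andP[x0 x1] z1; have [->|xn0] := eqVneq x 0.
  rewrite mul0r /rcorr (_ : rvar 0 1 * rvar 0 z = z ^+ 2); last by rewrite /rvar; ring.
  rewrite (_ : rcov 0 1 z = z); last by rewrite /rcov; ring.
  by rewrite sqrtr_sqr ger0_norm ?divff ?subrr// ?gt_eqF//; lra.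
have {xn0} {}x0 : 0 < x by rewrite lt_neqAle eq_sym xn0.
pose Q t := Num.sqrt (rvar t 1 * rvar t z).
pose f t : R := (1 - rcorr t 1 z) / t.
have pq0 t : 0 < rvar t 1 * rvar t z.
  by rewrite mulr_gt0// rvar_gt0//; lra.
pose dP t := (2 * t - 1) * rvar t z + rvar t 1 * (2 * t - z).
have dfE t : 0 < t -> is_derive t 1 f
    ((t * (rcov t 1 z * (dP t / (2 * Q t)) - (- (1 + z) / 2 - t) * Q t)
      - Q t * (Q t - rcov t 1 z)) / (t * Q t) ^+ 2).
  move=> t0; apply: is_derive_one_sub_div.
  - exact: is_derive_rcov.
  - have dp := is_derive_rvar 1 t; have dq := is_derive_rvar z t.
    have dpq : is_derive t 1 (fun t => rvar t 1 * rvar t z) (dP t).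
      by apply: is_derive_eq; rewrite /GRing.scale /= /dP; ring.
    have ds := is_derive1_sqrt (pq0 t).
    by apply: is_derive_eq; rewrite /GRing.scale /= mulrC.
  - by rewrite gt_eqF// sqrtr_gt0.
  - by rewrite gt_eqF.
have f_ndecr : f x <= f 1.
  apply: (ger0_derive1_ndecr _ _ _ (lexx x) x1 (lexx 1)).
  - by move=> t; rewrite in_itv/= => /andP[xt _]; have [|//] := dfE t; lra.
  - move=> t; rewrite in_itv/= => /andP[xt t1]; have t0 : 0 < t by lra.
    rewrite derive1E; have h := dfE t t0; rewrite derive_val.
    rewrite divr_ge0 ?sqr_ge0//.
    have Q0 : 0 < Q t by rewrite sqrtr_gt0.
    rewrite -(pmulr_rge0 _ Q0).
    have : 0 < t <= 1 by lra.
    move=> /rcorr_slope_ge0 - /(_ _ z1); rewrite -/(Q t).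
    have Q2 : Q t ^+ 2 = rvar t 1 * rvar t z by rewrite sqr_sqrtr// ltW.
    rewrite -subr_ge0; congr (0 <= _).
    have -> : Q t * (t * (rcov t 1 z * (dP t / (2 * Q t)) -
          (- (1 + z) / 2 - t) * Q t) - Q t * (Q t - rcov t 1 z)) =
        t * (rcov t 1 z * dP t / 2 - (- (1 + z) / 2 - t) * Q t ^+ 2) -
        Q t ^+ 2 * (Q t - rcov t 1 z).
      by move: (Q t) (rcov t 1 z) (dP t) Q0 => q n d q0; field; rewrite gt_eqF.
    by rewrite Q2; congr (_ - _); rewrite /dP /rcov /rvar; field.
  - apply: derivable_within_continuous => t; rewrite in_itv/= => /andP[xt _].
    by have [|//] := dfE t; lra.
by move: f_ndecr; rewrite /f divr1 ler_pdivrMr// mulrC.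
Qed.

(** * One step: order preservation and contraction *)

(** The determinant of A(1 - x, 1 - y, 1 - z). *)
Definition gramdet x y z : R :=
  2 * (x * y + y * z + z * x) - x ^+ 2 - y ^+ 2 - z ^+ 2 - 2 * x * y * z.

(** The nondegenerate elliptope in the coordinates x, y, z, see
    [E3nd_admissible]. *)
Definition admissible x y z :=
  [/\ 0 <= x <= 2, 0 <= y <= 2, 0 <= z <= 2, 0 <= gramdet x y z & 0 < x + y + z].

Lemma admissible_swap12 x y z : admissible x y z -> admissible y x z.
Proof.
case=> x2 y2 z2 g s; split=> //; last lra.
by rewrite (_ : gramdet _ _ _ = gramdet x y z)// /gramdet; ring.
Qed.

Lemma admissible_swap23 x y z : admissible x y z -> admissible x z y.
Proof.
case=> x2 y2 z2 g s; split=> //; last lra.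
by rewrite (_ : gramdet _ _ _ = gramdet x y z)// /gramdet; ring.
Qed.

(** The elliptope inequality gives (z - y)^2 <= 2 x (y + z): a small x forces y
    and z to be close to each other, and in any case z <= 5 y. *)
Lemma admissible_sorted x y z : admissible x y z -> x <= y -> y <= z ->
  [/\ 0 <= x, 0 < y, z <= 5 * y & (z - y) ^+ 2 <= 12 * x * y].
Proof.
case=> /andP[x0 x2] /andP[y0 y2] /andP[z0 z2] g s xy yz; rewrite /gramdet in g.
have d1 : (z - y) ^+ 2 <= 2 * x * (y + z).
  have xyz := mulr_ge0 (mulr_ge0 x0 y0) z0; have xx := sqr_ge0 x; lra.
have yy : 0 < y.
  rewrite lt_neqAle y0 andbT; apply/eqP => ye.
  have xe : x = 0 by lra.
  by move: d1; rewrite xe -ye; have : 0 < z ^+ 2; [rewrite exprn_gt0//; lra|lra].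
have z5 : z <= 5 * y by nra.
split=> //; apply: le_trans d1 _.
have : x * (y + z) <= x * (6 * y) by rewrite ler_wpM2l//; lra.
lra.
Qed.

Lemma rcorr_lowest_chord x y z : 0 <= x -> x <= y -> y <= z -> 0 < y ->
  y * (1 - rcorr x y z) <= x * (1 - rcorr y y z).
Proof.
move=> x0 xy yz y0; rewrite -(rcorr_div x y z y0) -(rcorr_div y y z y0).
rewrite divff ?gt_eqF//.
have := @rcorr_lowest_chord1 (x / y) (z / y).
rewrite divr_ge0 ?(ltW y0)//= ler_pdivrMr// mul1r xy ler_pdivlMr// mul1r yz.
move=> /(_ isT isT); rewrite -(ler_pM2l y0); congr (_ <= _).
by rewrite mulrA [y * (_ / _)]mulrC divfK// gt_eqF.
Qed.

Lemma rcorr_middle_gap x y z : 0 <= x -> x <= y -> y <= z -> 0 < y -> z <= 5 * y ->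
  (1 + (1 - x / y) / 7) * (1 - rcorr y y z) <= 1 - rcorr y x z.
Proof.
move=> x0 xy yz y0 z5; rewrite -(rcorr_div y y z y0) -(rcorr_div y x z y0).
rewrite divff ?gt_eqF//; apply: rcorr_middle_gap1.
  by rewrite divr_ge0 ?(ltW y0)//= ler_pdivrMr// mul1r.
by rewrite ler_pdivlMr// mul1r yz ler_pdivrMr.
Qed.

Lemma rcorr_le1 x y z : rcorr x y z <= 1.
Proof. by have := normr_rcorr_le1 x y z; rewrite ler_norml => /andP[]. Qed.

Lemma rcorr_geN1 x y z : -1 <= rcorr x y z.
Proof. by have := normr_rcorr_le1 x y z; rewrite ler_norml => /andP[]. Qed.

(** Both new coordinates are compared with their common value at (y, y, z), the
    smallest by [rcorr_lowest_chord] and the middle one by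
    [rcorr_middle_gap]. *)
Lemma rcorr_ratio x y z : admissible x y z -> x <= y -> y <= z ->
  y * (1 + (1 - x / y) / 7) * (1 - rcorr x y z) <= x * (1 - rcorr y x z).
Proof.
move=> a xy yz; have [x0 y0 z5 _] := admissible_sorted a xy yz.
have h1 := rcorr_lowest_chord x0 xy yz y0.
have h2 := rcorr_middle_gap x0 xy yz y0 z5.
have k0 : 0 <= 1 + (1 - x / y) / 7.
  have : x / y <= 1 by rewrite ler_pdivrMr// mul1r.
  lra.
have := ler_wpM2l k0 h1; have := ler_wpM2l x0 h2; nra.
Qed.

Lemma rcorr_le_bottom x y z : admissible x y z -> x <= y -> y <= z ->
  rcorr y x z <= rcorr x y z.
Proof.
move=> a xy yz; have [x0 y0 z5 _] := admissible_sorted a xy yz.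
have h := rcorr_ratio a xy yz.
have k1 : 0 <= (1 - x / y) / 7.
  have : x / y <= 1 by rewrite ler_pdivrMr// mul1r.
  lra.
have X1 := rcorr_le1 x y z; have Y1 := rcorr_le1 y x z.
have e1 : 0 <= y * ((1 - x / y) / 7) * (1 - rcorr x y z).
  by rewrite mulr_ge0 ?subr_ge0// mulr_ge0// ltW.
have e2 : x * (1 - rcorr y x z) <= y * (1 - rcorr y x z).
  by rewrite ler_wpM2r// subr_ge0.
by rewrite -(ler_pM2l y0); nra.
Qed.

(** The sorted cases [rcorr_le_bottom] and [rcorr_le_top] compare neighbouring
    coordinates; when z lies between x and y they are chained. *)
Lemma rcorr_antitone x y z : admissible x y z -> x <= y -> rcorr y x z <= rcorr x y z.
Proof.
move=> a xy; have [yz|/ltW zy] := leP y z; first exact: rcorr_le_bottom.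
have [zx|/ltW xz] := leP z x.
  have a' := admissible_swap12 (admissible_swap23 a).
  have [z0 x0 _ _] := admissible_sorted a' zx xy.
  by rewrite (rcorrC y) (rcorrC x); exact: rcorr_le_top.
have a' := admissible_swap23 a.
have [x0 z0 _ _] := admissible_sorted a' xz zy.
have := rcorr_le_bottom a' xz zy; have := rcorr_le_top x0 xz zy z0.
by rewrite (rcorrC x z) => /le_trans; apply.
Qed.

Lemma admissible_rvar_gt0 x y z : admissible x y z ->
  [/\ 0 < rvar x y, 0 < rvar x z & 0 < rvar y z].
Proof.
have aux u v w : admissible u v w -> 0 < rvar u v.
  case=> /andP[u0 _] /andP[v0 _] _ g s; have [vpos|vn] := ltP 0 v.
    exact: rvar_gt0.
  rewrite rvarC rvar_gt0// lt_neqAle u0 andbT; apply/eqP => ue.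
  have ve : v = 0 by lra.
  move: g s; rewrite /gramdet -ue ve => g s.
  by have : 0 < w ^+ 2; [rewrite exprn_gt0//; lra|lra].
move=> a; split; first exact: aux a.
  exact: aux (admissible_swap23 a).
exact: aux (admissible_swap23 (admissible_swap12 a)).
Qed.

(** A matrix of correlations of vectors that lie in the plane orthogonal to
    (1, 1, 1) is a Gram matrix of rank at most 2. *)
Lemma gramdet_step x y z : admissible x y z ->
  gramdet (1 - rcorr x y z) (1 - rcorr y x z) (1 - rcorr z x y) = 0.
Proof.
case/admissible_rvar_gt0 => p0 q0 r0.
rewrite /rcorr (rvarC y x) (rvarC z x) (rvarC z y).
rewrite !sqrtrM ?(ltW p0) ?(ltW q0) ?(ltW r0)//.
set P := Num.sqrt (rvar x y); set Q := Num.sqrt (rvar x z).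
set W := Num.sqrt (rvar y z).
have P0 : P != 0 by rewrite gt_eqF// sqrtr_gt0.
have Q0 : Q != 0 by rewrite gt_eqF// sqrtr_gt0.
have W0 : W != 0 by rewrite gt_eqF// sqrtr_gt0.
have P2 : P ^+ 2 = rvar x y by rewrite sqr_sqrtr// ltW.
have Q2 : Q ^+ 2 = rvar x z by rewrite sqr_sqrtr// ltW.
have W2 : W ^+ 2 = rvar y z by rewrite sqr_sqrtr// ltW.
set A := rcov x y z; set B := rcov y x z; set C := rcov z x y.
have -> : gramdet (1 - A / (P * Q)) (1 - B / (P * W)) (1 - C / (Q * W)) =
    (P ^+ 2 * Q ^+ 2 * W ^+ 2 + 2 * A * B * C -
     A ^+ 2 * W ^+ 2 - B ^+ 2 * Q ^+ 2 - C ^+ 2 * P ^+ 2) / (P * Q * W) ^+ 2.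
  by rewrite /gramdet; clearbody P Q W A B C; field; rewrite P0 Q0 W0.
rewrite P2 Q2 W2 [X in X / _](_ : _ = 0) ?mul0r//.
by rewrite /A /B /C /rcov /rvar; field.
Qed.

(** The three correlations are not all 1, since the sum of the covariances is
    - (x^2 + y^2 + z^2) / 2 < 0. *)
Lemma admissible_step x y z : admissible x y z ->
  admissible (1 - rcorr x y z) (1 - rcorr y x z) (1 - rcorr z x y).
Proof.
move=> a; have g := gramdet_step a; case: a => _ _ _ _ s.
have b (u v w : R) : 0 <= 1 - rcorr u v w <= 2.
  by have := rcorr_le1 u v w; have := rcorr_geN1 u v w; lra.
have pos (u v w : R) : rcov u v w < 0 -> 0 < 1 - rcorr u v w.
  move=> n; suff : rcorr u v w <= 0 by lra.
  by rewrite /rcorr mulr_le0_ge0// ?invr_ge0 ?sqrtr_ge0// ltW.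
split; rewrite ?b ?g//.
have /andP[bx _] := b x y z; have /andP[b_y _] := b y x z.
have /andP[bz _] := b z x y.
have neg : rcov x y z + rcov y x z + rcov z x y < 0.
  rewrite /rcov; have := sqr_ge0 x; have := sqr_ge0 y; have := sqr_ge0 z.
  have : 0 < (x + y + z) ^+ 2 by rewrite exprn_gt0.
  have := sqr_ge0 (x - y); have := sqr_ge0 (x - z); have := sqr_ge0 (y - z); nra.
have [/pos|hx] := ltP (rcov x y z) 0; first by lra.
have [/pos|hy] := ltP (rcov y x z) 0; first by lra.
have [/pos|hz] := ltP (rcov z x y) 0; first by lra.
lra.
Qed.

(** The contraction in the form that iterates: t bounds the current ratio and s
    the initial one, so the factor r is the same at every step. *)
Lemma step_contract_sorted x y z t s : admissible x y z -> x <= y -> y <= z ->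
  x <= t * y -> t <= s -> s < 1 -> 0 <= t ->
  let r := (1 + (1 - s) / 7)^-1 in
  1 - rcorr x y z <= t * r * (1 - rcorr y x z) /\
  1 - rcorr x y z <= t * r * (1 - rcorr z x y).
Proof.
move=> a xy yz xt ts s1 t0 r.
have [x0 y0 z5 _] := admissible_sorted a xy yz.
have h := rcorr_ratio a xy yz.
have k0 : 0 < 1 + (1 - s) / 7 by lra.
have xys : x / y <= s by apply: le_trans ts; rewrite ler_pdivrMr.
have X0 : 0 <= 1 - rcorr x y z by rewrite subr_ge0 rcorr_le1.
have Y0 : 0 <= 1 - rcorr y x z by rewrite subr_ge0 rcorr_le1.
have lo : 1 - rcorr x y z <= t * r * (1 - rcorr y x z).
  have -> : t * r * (1 - rcorr y x z) = t * (1 - rcorr y x z) / (1 + (1 - s) / 7).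
    by rewrite /r mulrAC.
  rewrite ler_pdivlMr// -(ler_pM2l y0).
  have e1 : x * (1 - rcorr y x z) <= t * y * (1 - rcorr y x z) by rewrite ler_wpM2r.
  have e2 : (1 - rcorr x y z) * (1 + (1 - s) / 7) <=
      (1 - rcorr x y z) * (1 + (1 - x / y) / 7).
    by rewrite ler_wpM2l//; lra.
  have := ler_wpM2l (ltW y0) e2; nra.
split=> //; apply: le_trans lo _.
rewrite ler_wpM2l ?mulr_ge0 ?invr_ge0 ?(ltW k0)// lerD2l lerN2.
have a' := admissible_swap23 (admissible_swap12 a).
by rewrite (rcorrC z) (rcorrC y); apply: rcorr_antitone.
Qed.

Lemma step_contract x y z t s : admissible x y z -> x <= t * y -> x <= t * z ->
  t <= s -> s < 1 -> 0 <= t ->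
  let r := (1 + (1 - s) / 7)^-1 in
  1 - rcorr x y z <= t * r * (1 - rcorr y x z) /\
  1 - rcorr x y z <= t * r * (1 - rcorr z x y).
Proof.
move=> a xy xz ts s1 t0 r.
have [x0 y0 z0] : [/\ 0 <= x, 0 <= y & 0 <= z].
  by case: a => /andP[? _] /andP[? _] /andP[? _].
have [yz|/ltW zy] := leP y z.
  by apply: step_contract_sorted => //; nra.
rewrite and_comm (rcorrC x) (rcorrC y) (rcorrC z).
have := @step_contract_sorted x z y t s (admissible_swap23 a).
by rewrite (rcorrC y) (rcorrC z); apply=> //; nra.
Qed.

(** When x z is at most (1 + z) / 2 the covariance is nonpositive and the
    denominator, at most z, can be replaced by z; otherwise x > 1 / 2 and the
    right-hand side exceeds 2. *)
Lemma rcorr_middle_near1 x z : 0 <= x <= 1 -> 1 <= z ->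
  1 + rcorr 1 x z <= z - 1 + 4 * x.
Proof.
move=> /andP[x0 x1] z1; have := rcorr_le1 1 x z.
have [h|h] := leP (x * z - (1 + z) / 2) 0; last first.
  by have : 1 / 2 <= x; [nra|lra].
move=> _; have p0 : 0 < rvar 1 x by rewrite rvarC rvar_gt0.
have q0 : 0 < rvar 1 z by rewrite rvar_gt0//; lra.
have Q0 : 0 < Num.sqrt (rvar 1 x * rvar 1 z) by rewrite sqrtr_gt0 mulr_gt0.
have Qz : Num.sqrt (rvar 1 x * rvar 1 z) <= z.
  rewrite -[leRHS]ger0_norm; last lra.
  rewrite -sqrtr_sqr ler_wsqrtr// -[leRHS]mul1r.
  by apply: ler_pM; rewrite ?(ltW p0) ?(ltW q0)// /rvar; nra.
have z0 : 0 < z by lra.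
have : rcorr 1 x z <= (x * z - (1 + z) / 2) / z.
  rewrite /rcorr; apply: (@le_trans _ _
      ((x * z - (1 + z) / 2) / Num.sqrt (rvar 1 x * rvar 1 z))).
    by rewrite ler_wpM2r ?invr_ge0 ?(ltW Q0)// /rcov; lra.
  by rewrite ler_wnM2l// lef_pV2 ?posrE.
suff : (x * z - (1 + z) / 2) / z <= z - 2 + 4 * x by lra.
by rewrite ler_pdivrMr//; nra.
Qed.

(** If x is small compared with y and z, the step sends y and z close to 2; the
    square root is the bound on z / y - 1 given by [admissible_sorted]. *)
Lemma step_near2 x y z t : admissible x y z ->
  x <= t * y -> x <= t * z -> 0 <= t <= 1 ->
  1 + rcorr y x z <= Num.sqrt (12 * t) + 4 * t /\
  1 + rcorr z x y <= Num.sqrt (12 * t) + 4 * t.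
Proof.
wlog yz : y z / y <= z.
  move=> wl a xy xz t01; have [yz|/ltW zy] := leP y z; first exact: wl.
  have [h1 h2] := wl _ _ zy (admissible_swap23 a) xz xy t01.
  by split.
move=> a xt _ /andP[t0 t1].
have xy : x <= y.
  by apply: le_trans xt _; case: a => _ /andP[y0 _] _ _ _; nra.
have [x0 y0 z5 d] := admissible_sorted a xy yz.
suff lo : 1 + rcorr y x z <= Num.sqrt (12 * t) + 4 * t.
  split=> //; apply: le_trans lo; rewrite lerD2l (rcorrC y) (rcorrC z).
  by apply: rcorr_antitone => //; apply: admissible_swap23; exact: admissible_swap12.
rewrite -(rcorr_div y x z y0) divff ?gt_eqF//.
have xyt : x / y <= t by rewrite ler_pdivrMr.
have sq : z / y - 1 <= Num.sqrt (12 * t).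
  have zy0 : 0 <= z / y - 1 by rewrite subr_ge0 ler_pdivlMr// mul1r.
  rewrite -(ger0_norm zy0) -sqrtr_sqr ler_wsqrtr//.
  have -> : (z / y - 1) ^+ 2 = (z - y) ^+ 2 / y ^+ 2 by field; rewrite gt_eqF.
  rewrite ler_pdivrMr ?exprn_gt0//; apply: le_trans d _.
  have := ler_wpM2r (ltW y0) xt; nra.
have := @rcorr_middle_near1 (x / y) (z / y).
rewrite divr_ge0 ?(ltW y0)//= ler_pdivrMr// mul1r xy ler_pdivlMr// mul1r yz.
by move=> /(_ isT isT); lra.
Qed.

(** * Orbits and the description of the basins *)

Definition orbit (X Y Z : nat -> R) := forall k,
  [/\ X k.+1 = 1 - rcorr (X k) (Y k) (Z k),
      Y k.+1 = 1 - rcorr (Y k) (X k) (Z k) &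
      Z k.+1 = 1 - rcorr (Z k) (X k) (Y k)].

Lemma orbit_swap12 X Y Z : orbit X Y Z -> orbit Y X Z.
Proof. by move=> o k; have [? ? ?] := o k; split=> //; rewrite (rcorrC (Z k)). Qed.

Lemma orbit_swap23 X Y Z : orbit X Y Z -> orbit X Z Y.
Proof. by move=> o k; have [? ? ?] := o k; split=> //; rewrite (rcorrC (X k)). Qed.

Lemma orbit_admissible X Y Z : orbit X Y Z -> admissible (X 0%N) (Y 0%N) (Z 0%N) ->
  forall k, admissible (X k) (Y k) (Z k).
Proof.
move=> o a; elim=> // k ih; have [-> -> ->] := o k; exact: admissible_step.
Qed.

Lemma orbit_le X Y Z : orbit X Y Z -> admissible (X 0%N) (Y 0%N) (Z 0%N) ->
  X 0%N <= Y 0%N -> forall k, X k <= Y k.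
Proof.
move=> o a h; elim=> // k ih; have [-> -> _] := o k.
by rewrite lerD2l lerN2; apply: rcorr_antitone => //; exact: orbit_admissible.
Qed.

(** The initial ratio s is less than 1, and [step_contract] bounds the ratios at
    time k by s r^k with r < 1. *)
Lemma orbit_cvg X Y Z : orbit X Y Z -> admissible (X 0%N) (Y 0%N) (Z 0%N) ->
  X 0%N < Y 0%N -> X 0%N < Z 0%N ->
  [/\ X k @[k --> \oo] --> (0 : R), Y k @[k --> \oo] --> (2 : R) &
      Z k @[k --> \oo] --> (2 : R)].
Proof.
move=> o a XY XZ; have ak := orbit_admissible o a.
have X0 : 0 <= X 0%N by case: a => /andP[].
have Y0 : 0 < Y 0%N by apply: le_lt_trans XY.
have Z0 : 0 < Z 0%N by apply: le_lt_trans XZ.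
pose s := Num.max (X 0%N / Y 0%N) (X 0%N / Z 0%N).
have s0 : 0 <= s by rewrite /s le_max divr_ge0// ltW.
have s1 : s < 1 by rewrite /s gt_max !ltr_pdivrMr// !mul1r XY.
have Xs : X 0%N <= s * Y 0%N /\ X 0%N <= s * Z 0%N.
  by rewrite -!ler_pdivrMr// /s !le_max !lexx orbT.
pose r := (1 + (1 - s) / 7)^-1.
have r0 : 0 < r by rewrite invr_gt0; lra.
have r1 : r < 1 by rewrite invf_lt1; lra.
pose t k := s * r ^+ k.
have t0 k : 0 <= t k by rewrite mulr_ge0// exprn_ge0// ltW.
have ts k : t k <= s by rewrite ler_piMr// exprn_ile1// ltW.
have Xt k : X k <= t k * Y k /\ X k <= t k * Z k.
  elim: k => [|k [ihY ihZ]]; first by rewrite /t expr0 mulr1.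
  have [-> -> ->] := o k; rewrite /t exprSr mulrA.
  exact: step_contract (ak k) ihY ihZ (ts k) s1 (t0 k).
have t_cvg : t k @[k --> \oo] --> (0 : R).
  by apply: cvg_geometric; rewrite ger0_norm// ltW.
have e_cvg : (Num.sqrt (12 * t k) + 4 * t k) @[k --> \oo] --> (0 : R).
  rewrite -[X in _ --> X](_ : Num.sqrt (12 * 0) + 4 * 0 = 0 :> R); last first.
    by rewrite !mulr0 sqrtr0 addr0.
  apply: cvgD; last by apply: cvgMl_tmp.
  apply: continuous_cvg; first exact: sqrt_continuous.
  by apply: cvgMl_tmp.
have two (W : nat -> R) : (forall k, W k.+1 <= 2) ->
    (forall k, 2 - W k.+1 <= Num.sqrt (12 * t k) + 4 * t k) ->
    W k @[k --> \oo] --> (2 : R).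
  move=> W2 We; rewrite -(cvg_shiftS W).
  apply: (@squeeze_cvgr _ _ _ _
    (fun k => 2 - (Num.sqrt (12 * t k) + 4 * t k)) (fun=> 2)).
  - by apply: nearW => k; have := We k; rewrite W2 andbT /=; lra.
  - by rewrite -[X in _ --> X](subr0 2); apply: cvgB => //; exact: cvg_cst.
  - exact: cvg_cst.
have t01 k : 0 <= t k <= 1 by rewrite t0/= (le_trans (ts k))// ltW.
split.
- apply: (@squeeze_cvgr _ _ _ _ (fun=> 0) (fun k => 2 * t k)).
  + apply: nearW => k; have [XtY _] := Xt k.
    case: (ak k) => /andP[-> _] /andP[_ Y2] _ _ _ /=.
    by apply: le_trans XtY _; rewrite mulrC ler_wpM2r.
  + exact: cvg_cst.
  + by rewrite -[X in _ --> X](mulr0 2); apply: cvgMl_tmp.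
- apply: two => k; first by case: (ak k.+1) => _ /andP[].
  have [_ -> _] := o k; have [XY' XZ'] := Xt k.
  have [h _] := step_near2 (ak k) XY' XZ' (t01 k).
  by apply: le_trans h; lra.
- apply: two => k; first by case: (ak k.+1) => _ _ /andP[].
  have [_ _ ->] := o k; have [XY' XZ'] := Xt k.
  have [_ h] := step_near2 (ak k) XY' XZ' (t01 k).
  by apply: le_trans h; lra.
Qed.

Lemma sum3 (F : 'I_3 -> R) : \sum_k F k = F (inord 0) + F (inord 1) + F (inord 2).
Proof.
rewrite !big_ord_recl big_ord0 addr0 addrA.
by congr (F _ + F _ + F _); apply/val_inj; rewrite /= inordK.
Qed.

Lemma Tmap_rcorr x y z :
  Tmap (1 - x, 1 - y, 1 - z) = (rcorr x y z, rcorr y x z, rcorr z x y).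
Proof.
have ratio (u v N P Q : R) : u = 2 / 3 * N ->
    v = 2 / 3 * P * (2 / 3 * Q) -> u / Num.sqrt v = N / Num.sqrt (P * Q).
  move=> -> ->.
  rewrite (_ : 2 / 3 * P * (2 / 3 * Q) = (2 / 3) ^+ 2 * (P * Q)); last by field.
  rewrite sqrtrM ?sqr_ge0// sqrtr_sqr ger0_norm; last lra.
  by rewrite -mulf_div divff ?mul1r//; lra.
rewrite /Tmap /offdiag /corr_map !mxE /corr /mean !sum3 !mxE !inordK//=.
by congr (_, _, _); apply: ratio; rewrite /rcov /rvar; field.
Qed.

Lemma E3nd_admissible p : E3nd p <-> admissible (1 - p.1.1) (1 - p.1.2) (1 - p.2).
Proof.
case: p => [[a b] c]; split=> /= [[[/andP[a1 a2] /andP[b1 b2] /andP[c1 c2] d] nc]|h].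
  split; try lra; first by rewrite /gramdet; lra.
  rewrite lt_neqAle; apply/andP; split; last by lra.
  apply/eqP => s.
  have [ea eb] : a = 1 /\ b = 1 by split; lra.
  have [k [l]] := nc (inord 0).
  rewrite ea eb !mxE !inordK//= => /negP[].
  by case: k => [[|[|[|//]]] ?]; case: l => [[|[|[|//]]] ?].
have [p0 q0 r0] := admissible_rvar_gt0 h; case: h => /andP[? ?] /andP[? ?] /andP[? ?] g _.
split; first by split; rewrite /gramdet in g; lra.
have off (i : 'I_3) j k (u v : R) : Amx (a, b, c) i i = 1 -> Amx (a, b, c) i j = u ->
    Amx (a, b, c) i k = v -> 0 < rvar (1 - u) (1 - v) ->
    nonconstant (row i (Amx (a, b, c))).
  move=> hi hj hk; have [u1|u1 _] := eqVneq u 1; last first.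
    by exists j, i; rewrite mxE [X in _ != X]mxE hi hj.
  have [v1|v1 _] := eqVneq v 1; last first.
    by exists k, i; rewrite mxE [X in _ != X]mxE hi hk.
  by rewrite /rvar u1 v1 => h; exfalso; lra.
move=> [[|[|[|//]]] H].
- by apply: (off _ (inord 1) (inord 2) _ _ _ _ _ p0); rewrite !mxE ?inordK.
- by apply: (off _ (inord 0) (inord 2) _ _ _ _ _ q0); rewrite !mxE ?inordK.
- by apply: (off _ (inord 0) (inord 1) _ _ _ _ _ r0); rewrite !mxE ?inordK.
Qed.

Lemma orbit_iter p : orbit (fun k => 1 - (iter k Tmap p).1.1)
  (fun k => 1 - (iter k Tmap p).1.2) (fun k => 1 - (iter k Tmap p).2).
Proof.
move=> k; rewrite iterS; case: (iter k Tmap p) => [[a b] c].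
by have := Tmap_rcorr (1 - a) (1 - b) (1 - c); rewrite !subKr => ->.
Qed.

Definition ltcompat (u v a b : R) := (u < v -> a < b) /\ (v < u -> b < a).

Definition same_order q p := [/\ ltcompat q.1.1 q.1.2 p.1.1 p.1.2,
  ltcompat q.1.1 q.2 p.1.1 p.2 & ltcompat q.1.2 q.2 p.1.2 p.2].

Lemma cvg_fst_coord (W : Type) (F : set_system W) {FF : Filter F}
    (T U : topologicalType) (u : W -> T * U) (l : T * U) :
  u k @[k --> F] --> l -> (u k).1 @[k --> F] --> l.1.
Proof.
move=> ul A nA; apply: (ul (fst @^-1` A)).
by exists (A, setT) => [|[x y] []//]; split => //; exact: filterT.
Qed.

Lemma cvg_snd_coord (W : Type) (F : set_system W) {FF : Filter F}
    (T U : topologicalType) (u : W -> T * U) (l : T * U) :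
  u k @[k --> F] --> l -> (u k).2 @[k --> F] --> l.2.
Proof.
move=> ul A nA; apply: (ul (snd @^-1` A)).
by exists (setT, A) => [|[x y] []//]; split => //; exact: filterT.
Qed.

Lemma cvg_coord (u : nat -> R * R * R) q : u k @[k --> \oo] --> q <->
  [/\ (u k).1.1 @[k --> \oo] --> q.1.1, (u k).1.2 @[k --> \oo] --> q.1.2 &
      (u k).2 @[k --> \oo] --> q.2].
Proof.
case: q => [[a b] c]; split=> [h|[ha hb hc]] /=.
  by split; [exact: cvg_fst_coord (cvg_fst_coord h)|
             exact: cvg_snd_coord (cvg_fst_coord h)|exact: cvg_snd_coord h].
have h := cvg_pair (cvg_pair ha hb) hc.
have -> : u = fun k => ((u k).1.1, (u k).1.2, (u k).2).
  by apply/funext => k; case: (u k) => [[]].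
exact: h.
Qed.

(** By [orbit_le] the opposite weak inequality would persist in the limit q. *)
Lemma basin_same_order q p : basin q p -> same_order q p.
Proof.
move=> [/E3nd_admissible a /cvg_coord[/= ha hb hc]].
have ltc (X Y Z : nat -> R) l m : orbit X Y Z -> admissible (X 0%N) (Y 0%N) (Z 0%N) ->
    X k @[k --> \oo] --> l -> Y k @[k --> \oo] --> m -> l < m -> X 0%N < Y 0%N.
  move=> o a0 hX hY lm; rewrite ltNge; apply/negP => YX.
  suff : m <= l by rewrite leNgt lm.
  apply: (ler_cvg_to hY hX); apply: nearW => k.
  exact: orbit_le (orbit_swap12 o) (admissible_swap12 a0) YX k.
have flip (u v : R) : 1 - u < 1 - v -> v < u by lra.
have oo := orbit_iter p.
have cvg1B (u : nat -> R) l :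
    u k @[k --> \oo] --> l -> (1 - u k) @[k --> \oo] --> 1 - l.
  by move=> h; apply: cvgB => //; exact: cvg_cst.
have {}ha := cvg1B _ _ ha; have {}hb := cvg1B _ _ hb; have {}hc := cvg1B _ _ hc.
split; split=> h; apply: flip.
- apply: (ltc _ _ _ _ _ (orbit_swap12 oo) (admissible_swap12 a) hb ha); lra.
- apply: (ltc _ _ _ _ _ oo a ha hb); lra.
- apply: (ltc _ _ _ _ _ (orbit_swap12 (orbit_swap23 oo))
    (admissible_swap12 (admissible_swap23 a)) hc ha); lra.
- apply: (ltc _ _ _ _ _ (orbit_swap23 oo) (admissible_swap23 a) ha hc); lra.
- apply: (ltc _ _ _ _ _ (orbit_swap23 (orbit_swap12 (orbit_swap23 oo)))
    (admissible_swap23 (admissible_swap12 (admissible_swap23 a))) hc hb); lra.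
- apply: (ltc _ _ _ _ _ (orbit_swap23 (orbit_swap12 oo))
    (admissible_swap23 (admissible_swap12 a)) hb hc); lra.
Qed.

(** A patterned point has one coordinate 1 and two coordinates -1, so having its
    order means having a strictly largest coordinate at the same place; then
    [orbit_cvg] applies after moving that place to the front. *)
Lemma basinE q : patterned q -> basin q = E3nd `&` [set p | same_order q p].
Proof.
move=> pq; apply/seteqP; split=> p.
  by move=> bp; split; [case: bp|exact: basin_same_order].
move=> [ndp /= so]; split=> //.
have a := (E3nd_admissible p).1 ndp; have oo := orbit_iter p.
have cvg1B (u : nat -> R) l :
    (1 - u k) @[k --> \oo] --> l -> u k @[k --> \oo] --> 1 - l.
  move=> h; have -> : u = fun k => 1 - (1 - u k).
    by apply/funext => k; rewrite subKr.
  by apply: cvgB => //; exact: cvg_cst.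
have e0 : 1 - 0 = 1 :> R by rewrite subr0.
have e2 : 1 - 2 = -1 :> R by lra.
apply/cvg_coord; case: pq so => -> [[/= ab ba] [/= ac ca] [/= bc cb]].
- have [||/cvg1B h1 /cvg1B h2 /cvg1B h3] := orbit_cvg oo a.
  + rewrite ltrD2l ltrN2; apply: ba; lra.
  + rewrite ltrD2l ltrN2; apply: ca; lra.
  + by rewrite e0 e2 in h1 h2 h3.
- have [||/cvg1B h1 /cvg1B h2 /cvg1B h3] :=
    orbit_cvg (orbit_swap12 oo) (admissible_swap12 a).
  + rewrite ltrD2l ltrN2; apply: ab; lra.
  + rewrite ltrD2l ltrN2; apply: cb; lra.
  + by rewrite e0 e2 in h1 h2 h3.
- have [||/cvg1B h1 /cvg1B h2 /cvg1B h3] :=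
    orbit_cvg (orbit_swap12 (orbit_swap23 oo))
      (admissible_swap12 (admissible_swap23 a)).
  + rewrite ltrD2l ltrN2; apply: ac; lra.
  + rewrite ltrD2l ltrN2; apply: bc; lra.
  + by rewrite e0 e2 in h1 h2 h3.
Qed.

End Dynamics.

(** * Regularity and symmetry of the basins *)

Section Symmetry.
Context {R : realType}.
Implicit Types (p q : R * R * R) (u v : R).

Lemma open_ltcompat u v (f g : R * R * R -> R) : continuous f -> continuous g ->
  open [set p | ltcompat u v (f p) (g p)].
Proof.
have op (P : Prop) (h k : R * R * R -> R) : continuous h -> continuous k ->
    open [set p | P -> h p < k p].
  move=> ch ck; have [hP|hP] := pselect P; last first.
    rewrite (_ : [set p | _] = setT); first exact: openT.
    by apply/seteqP; split=> p //= _ /hP.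
  rewrite (_ : [set p | _] = (fun p => k p - h p) @^-1` [set x | 0 < x]).
    apply: open_comp; last exact: open_gt.
    by move=> p _; apply: cvgB; [exact: ck|exact: ch].
  by apply/seteqP; split=> p /=; rewrite subr_gt0 => // h1; exact: h1.
move=> cf cg; rewrite (_ : [set p | _] = [set p | u < v -> f p < g p] `&`
  [set p | v < u -> g p < f p]); last by [].
by apply: openI; exact: op.
Qed.

Lemma open_same_order q : open [set p | same_order q p].
Proof.
have c12 : continuous (@fst (R * R) R).
  by move=> p; apply: cvg_fst_coord; exact: cvg_id.
have c1 : continuous (fun p => p.1.1) by move=> p; apply: cvg_fst_coord; exact: c12.
have c2 : continuous (fun p => p.1.2) by move=> p; apply: cvg_snd_coord; exact: c12.
have c3 : continuous (fun p => p.2) by move=> p; apply: cvg_snd_coord; exact: cvg_id.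
rewrite (_ : [set p | _] = [set p | ltcompat q.1.1 q.1.2 p.1.1 p.1.2] `&`
    [set p | ltcompat q.1.1 q.2 p.1.1 p.2] `&`
    [set p | ltcompat q.1.2 q.2 p.1.2 p.2]); last first.
  by apply/seteqP; split=> p [] => [h1 h2 h3|[h1 h2] h3]; split.
by apply: openI; [apply: openI|]; exact: open_ltcompat.
Qed.

Lemma measurable_ltcompat u v (f g : R * R * R -> R) :
  measurable_fun setT f -> measurable_fun setT g ->
  measurable [set p | ltcompat u v (f p) (g p)].
Proof.
have mlt (P : Prop) (h k : R * R * R -> R) :
    measurable_fun setT h -> measurable_fun setT k ->
    measurable [set p | P -> h p < k p].
  move=> mh mk; have [hP|hP] := pselect P; last first.
    rewrite (_ : [set p | _] = setT); first exact: measurableT.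
    by apply/seteqP; split=> p //= _ /hP.
  have mtrue : measurable [set true] by [].
  have := measurable_fun_ltr mh mk measurableT mtrue; rewrite setTI.
  by congr measurable; apply/seteqP; split=> p /=; [move=> -> | apply].
move=> mf mg; rewrite (_ : [set p | _] = [set p | u < v -> f p < g p] `&`
  [set p | v < u -> g p < f p]); last by [].
by apply: measurableI; exact: mlt.
Qed.

Let mc1 : measurable_fun setT (fun p : R * R * R => p.1.1).
Proof. by apply: measurableT_comp => //; exact: measurable_fst. Qed.
Let mc2 : measurable_fun setT (fun p : R * R * R => p.1.2).
Proof. by apply: measurableT_comp => //; exact: measurable_fst. Qed.
Let mc3 : measurable_fun setT (fun p : R * R * R => p.2).
Proof. exact: measurable_snd. Qed.

Lemma measurable_same_order q : measurable [set p | same_order q p].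
Proof.
rewrite (_ : [set p | _] = [set p | ltcompat q.1.1 q.1.2 p.1.1 p.1.2] `&`
    [set p | ltcompat q.1.1 q.2 p.1.1 p.2] `&`
    [set p | ltcompat q.1.2 q.2 p.1.2 p.2]); last first.
  by apply/seteqP; split=> p [] => [h1 h2 h3|[h1 h2] h3]; split.
by apply: measurableI; [apply: measurableI|]; exact: measurable_ltcompat.
Qed.

Lemma measurable_E3 : measurable (@E3 R).
Proof.
have mle (h k : R * R * R -> R) :
    measurable_fun setT h -> measurable_fun setT k ->
    measurable [set p | h p <= k p].
  move=> mh mk; have mtrue : measurable [set true] by [].
  have := measurable_fun_ler mh mk measurableT mtrue.
  by rewrite setTI.
have mbox (h : R * R * R -> R) : measurable_fun setT h ->
    measurable [set p | -1 <= h p <= 1].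
  move=> mh.
  rewrite (_ : [set p | _] = [set p | -1 <= h p] `&` [set p | h p <= 1]).
    by apply: measurableI; apply: mle => //; exact: measurable_cst.
  by apply/seteqP; split=> p /=; [move=> /andP[]|move=> [-> ->]].
rewrite (_ : E3 = [set p | -1 <= p.1.1 <= 1] `&` [set p | -1 <= p.1.2 <= 1] `&`
  [set p | -1 <= p.2 <= 1] `&`
  [set p | 0 <= 1 + 2 * p.1.1 * p.1.2 * p.2
               - p.1.1 ^+ 2 - p.1.2 ^+ 2 - p.2 ^+ 2]).
  apply: measurableI; last first.
    apply: mle; first exact: measurable_cst.
    repeat (apply: measurable_funB); try by exact: measurable_funX.
    apply: measurable_funD; first exact: measurable_cst.
    by repeat (apply: measurable_funM) => //; exact: measurable_cst.
  by apply: measurableI; [apply: measurableI|]; exact: mbox.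
by apply/seteqP; split=> [[[a b] c]|[[a b] c]] /=; [case=> *|case=> [[[]]]].
Qed.

(** Nondegeneracy is automatic: the only degenerate point has three equal
    coordinates. *)
Lemma basin_E3 q : patterned q -> basin q = E3 `&` [set p | same_order q p].
Proof.
move=> pq; rewrite basinE//; apply/seteqP; split=> p [h so]; split=> //.
  by case: h.
apply/E3nd_admissible; move: h so; case: p => [[a b] c].
move=> [/andP[a1 a2] /andP[b1 b2] /andP[c1 c2] d] so.
split=> /=; try lra; first by rewrite /gramdet; lra.
case: pq so => -> [[/= ab ba] [/= ac ca] [/= bc cb]].
- by have : b < a; [apply: ba; lra|lra].
- by have : a < b; [apply: ab; lra|lra].
- by have : a < c; [apply: ac; lra|lra].
Qed.

(** The properties of a permutation of the coordinates that transport the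
    description of the basins; they are stable under composition, so it is
    enough to check them on two transpositions. *)
Record coord_perm (f : R * R * R -> R * R * R) : Prop := CoordPerm {
  coord_perm_onto : forall p, exists p', f p' = p;
  coord_perm_E3 : forall p, E3 (f p) <-> E3 p;
  coord_perm_patterned : forall p, patterned (f p) <-> patterned p;
  coord_perm_order : forall q p, same_order (f q) (f p) <-> same_order q p }.

Lemma coord_perm_comp f g : coord_perm f -> coord_perm g -> coord_perm (f \o g).
Proof.
move=> [fo fE fp fs] [go gE gp gs]; split=> /= [p|p|p|q p].
- by have [p1 <-] := fo p; have [p2 <-] := go p1; exists p2.
- exact: iff_trans (fE _) (gE _).
- exact: iff_trans (fp _) (gp _).
- exact: iff_trans (fs _ _) (gs _ _).
Qed.

Definition swap12 p : R * R * R := (p.1.2, p.1.1, p.2).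
Definition swap23 p : R * R * R := (p.1.1, p.2, p.1.2).

Lemma coord_perm_id : coord_perm id.
Proof. by split=> // p; exists p. Qed.

Lemma coord_perm_swap12 : coord_perm swap12.
Proof.
split.
- by move=> [[a b] c]; exists (b, a, c).
- by move=> [[a b] c]; rewrite /E3 /=; split=> -[*]; split=> //; lra.
- move=> [[a b] c]; rewrite /patterned /swap12 /=; split.
    by case=> -[-> -> ->]; [apply: Or32|apply: Or31|apply: Or33].
  by case=> -[-> -> ->]; [apply: Or32|apply: Or31|apply: Or33].
- move=> [[a b] c] [[a' b'] c']; rewrite /same_order /ltcompat /=; split.
    by case=> -[h1 h2] [h3 h4] [h5 h6].
  by case=> -[h1 h2] [h3 h4] [h5 h6].
Qed.

Lemma coord_perm_swap23 : coord_perm swap23.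
Proof.
split.
- by move=> [[a b] c]; exists (a, c, b).
- by move=> [[a b] c]; rewrite /E3 /=; split=> -[*]; split=> //; lra.
- move=> [[a b] c]; rewrite /patterned /swap23 /=; split.
    by case=> -[-> -> ->]; [apply: Or31|apply: Or33|apply: Or32].
  by case=> -[-> -> ->]; [apply: Or31|apply: Or33|apply: Or32].
- move=> [[a b] c] [[a' b'] c']; rewrite /same_order /ltcompat /=; split.
    by case=> -[h1 h2] [h3 h4] [h5 h6].
  by case=> -[h1 h2] [h3 h4] [h5 h6].
Qed.

Lemma basin_coord_perm f q : coord_perm f -> patterned q ->
  basin q = f @^-1` basin (f q).
Proof.
move=> [_ fE fp fs] pq; rewrite !basin_E3//; last exact/fp.
by apply/seteqP; split=> p [/fE Ep /fs so].
Qed.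

Lemma ord3P (i : 'I_3) : [\/ i = inord 0, i = inord 1 | i = inord 2].
Proof.
case: i => [[|[|[|//]]] H].
- by apply: Or31; apply/val_inj; rewrite /= inordK.
- by apply: Or32; apply/val_inj; rewrite /= inordK.
- by apply: Or33; apply/val_inj; rewrite /= inordK.
Qed.

(** Each of the six permutations acts on the coordinates as a product of the two
    transpositions. *)
Lemma sact_coord_perm (s : 'S_3) : coord_perm (@sact R s).
Proof.
have s12 := coord_perm_swap12; have s23 := coord_perm_swap23.
have inj : injective (s^-1%g) by exact: perm_inj.
have diff (i j : 'I_3) : i != j -> s^-1%g i <> s^-1%g j.
  by move=> /eqP ij /inj.
have d01 := diff (inord 0) (inord 1); have d02 := diff (inord 0) (inord 2).
have d12 := diff (inord 1) (inord 2).
rewrite -!val_eqE /= !inordK// in d01 d02 d12.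
have {}d01 := d01 isT; have {}d02 := d02 isT; have {}d12 := d12 isT.
have sub f : coord_perm f -> f =1 sact s -> coord_perm (@sact R s).
  by move=> cf /funext <-.
have [h0|h0|h0] := ord3P (s^-1%g (inord 0));
  have [h1|h1|h1] := ord3P (s^-1%g (inord 1));
  have [h2|h2|h2] := ord3P (s^-1%g (inord 2));
  rewrite h0 h1 h2 in d01 d02 d12 => //.
all: [> apply: (sub _ coord_perm_id)
      | apply: (sub _ s12)
      | apply: (sub _ s23)
      | apply: (sub _ (coord_perm_comp s12 s23))
      | apply: (sub _ (coord_perm_comp s23 s12))
      | apply: (sub _ (coord_perm_comp s12 (coord_perm_comp s23 s12)))].
all: move=> [[a b] c]; rewrite /sact tr_perm_mx -row_permE -col_permE.
all: by rewrite /offdiag !mxE h0 h1 h2 !inordK.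
Qed.

End Symmetry.

(** * Measure of the basins *)

Section ProductSwap.
Local Open Scope ereal_scope.
Context d1 d2 (T1 : measurableType d1) (T2 : measurableType d2) (R : realType).
Context (m1 : {sigma_finite_measure set T1 -> \bar R}).
Context (m2 : {sigma_finite_measure set T2 -> \bar R}).

(** The product measure can be computed by integrating sections in either
    order. *)
Lemma product_measure_swap (A : set (T1 * T2)) : measurable A ->
  (m2 \x m1) [set z | A (z.2, z.1)] = (m1 \x m2) A.
Proof.
move=> mA; rewrite (@product_measure_unique _ _ _ _ _ m1 m2 (m1 \x^ m2))//.
by move=> B C mB mC; exact: product_measure2E.
Qed.

End ProductSwap.

Section Measure.
Context {R : realType}.
Local Notation leb := (@lebesgue_measure R).
Implicit Types (A : set (R * R * R)) (p q : R * R * R).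

Lemma measurable_swap12 : measurable_fun setT (@swap12 R).
Proof.
apply: measurable_fun_pair; last exact: measurable_snd.
apply: measurable_fun_pair; apply: measurableT_comp => //; exact: measurable_fst.
Qed.

Lemma measurable_swap23 : measurable_fun setT (@swap23 R).
Proof.
apply: measurable_fun_pair.
  apply: measurable_fun_pair; last exact: measurable_snd.
  by apply: measurableT_comp => //; exact: measurable_fst.
by apply: measurableT_comp => //; exact: measurable_fst.
Qed.

Lemma lambda3E A : lambda3 A = (\int[leb \x leb]_z (leb \o xsection A) z)%E.
Proof. by []. Qed.

(** The two iterated integrals of the linear measure of the sections agree. *)
Lemma lambda3_swap12 A : measurable A -> lambda3 (@swap12 R @^-1` A) = lambda3 A.
Proof.
move=> mA; rewrite !lambda3E.
have mf := measurable_fun_xsection leb mA.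
rewrite [RHS](@fubini_tonelli1 _ _ _ _ R leb leb _ mf)//.
have mB : measurable (@swap12 R @^-1` A).
  by rewrite -[X in measurable X]setTI; exact: measurable_swap12.
have mg := measurable_fun_xsection leb mB.
by rewrite [LHS](@fubini_tonelli2 _ _ _ _ R leb leb _ mg).
Qed.

Lemma lambda3_slice A : measurable A ->
  lambda3 A = (\int[leb]_a ((leb \x leb) [set z | A (a, z.1, z.2)]))%E.
Proof.
move=> mA; have mf := measurable_fun_xsection leb mA.
by rewrite lambda3E [LHS](@fubini_tonelli1 _ _ _ _ R leb leb _ mf).
Qed.

(** On each slice the swap exchanges the two factors of a planar product
    measure. *)
Lemma lambda3_swap23 A : measurable A -> lambda3 (@swap23 R @^-1` A) = lambda3 A.
Proof.
move=> mA.
have mB : measurable (@swap23 R @^-1` A).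
  by rewrite -[X in measurable X]setTI; exact: measurable_swap23.
rewrite (lambda3_slice mB) (lambda3_slice mA); apply: eq_integral => a _.
rewrite -[RHS]product_measure_swap//.
have mi : measurable_fun setT (fun z : R * R => ((a, z.1), z.2)).
  apply: measurable_fun_pair; last exact: measurable_snd.
  by apply: measurable_fun_pair; [exact: measurable_cst|exact: measurable_fst].
by rewrite -[X in measurable X]setTI; exact: mi.
Qed.

Lemma lambda3_tie23 : lambda3 [set p : R * R * R | p.1.2 = p.2] = 0%E.
Proof.
rewrite lambda3E; apply: integral0_eq => -[a b] _; rewrite [LHS]/=.
rewrite (_ : xsection _ _ = [set b]) ?lebesgue_measure_set1//.
by apply/seteqP; split=> z; rewrite /xsection /= !inE.
Qed.

Local Notation tie12 := [set p : R * R * R | p.1.1 = p.1.2].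
Local Notation tie13 := [set p : R * R * R | p.1.1 = p.2].
Local Notation tie23 := [set p : R * R * R | p.1.2 = p.2].

Lemma measurable_tie23 : measurable tie23.
Proof.
have mtrue : measurable [set true] by [].
have mc2 : measurable_fun setT (fun p : R * R * R => p.1.2).
  by apply: measurableT_comp => //; exact: measurable_fst.
have mc3 : measurable_fun setT (fun p : R * R * R => p.2) by exact: measurable_snd.
have := measurable_fun_eqr mc2 mc3 measurableT mtrue; rewrite setTI.
by congr measurable; apply/seteqP; split=> p /= /eqP.
Qed.

Lemma measurable_tie13 : measurable tie13.
Proof.
by have := measurable_swap12 measurableT measurable_tie23; rewrite setTI.
Qed.

Lemma measurable_tie12 : measurable tie12.
Proof.
by have := measurable_swap23 measurableT measurable_tie13; rewrite setTI.
Qed.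

Lemma measurable_ties : measurable (tie12 `|` tie13 `|` tie23).
Proof.
apply: measurableU; last exact: measurable_tie23.
by apply: measurableU; [exact: measurable_tie12|exact: measurable_tie13].
Qed.

Lemma lambda3U0 A B : measurable A -> measurable B -> lambda3 B = 0%E ->
  lambda3 (A `|` B) = lambda3 A.
Proof. by move=> mA mB B0; apply: measureU0. Qed.

Lemma lambda3_ties : lambda3 (tie12 `|` tie13 `|` tie23) = 0%E.
Proof.
have m12 := measurable_tie12; have m13 := measurable_tie13.
have z13 : lambda3 tie13 = 0%E.
  by rewrite -lambda3_tie23 -(lambda3_swap12 measurable_tie23).
have z12 : lambda3 tie12 = 0%E by rewrite -z13 -(lambda3_swap23 m13).
rewrite lambda3U0; [|exact: measurableU|exact: measurable_tie23|
  exact: lambda3_tie23].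
by rewrite lambda3U0.
Qed.

Lemma patterned1 : patterned ((1, -1, -1) : R * R * R).
Proof. by rewrite /patterned /=; apply: Or31. Qed.

Lemma patterned2 : patterned ((-1, 1, -1) : R * R * R).
Proof. by rewrite /patterned /=; apply: Or32. Qed.

Lemma patterned3 : patterned ((-1, -1, 1) : R * R * R).
Proof. by rewrite /patterned /=; apply: Or33. Qed.

Lemma E3_split : @E3 R =
  (basin (1, -1, -1) `|` basin (-1, 1, -1) `|` basin (-1, -1, 1)) `|`
  (E3 `&` (tie12 `|` tie13 `|` tie23)).
Proof.
rewrite (basin_E3 patterned1) (basin_E3 patterned2) (basin_E3 patterned3).
apply/seteqP; split=> [[[a b] c] Ep|p [[[]|]|] []//].
case: (ltgtP a b) Ep => [ab|ba|->] Ep; last by right; split=> //; left; left.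
- case: (ltgtP b c) Ep => [bc|cb|->] Ep; last by right; split=> //; right.
    left; right; split=> //; rewrite /= /same_order /ltcompat /=.
    by split; split=> h //=; lra.
  left; left; right; split=> //; rewrite /= /same_order /ltcompat /=.
  by split; split=> h //=; lra.
- case: (ltgtP a c) Ep => [ac|ca|->] Ep; last by right; split=> //; left; right.
    left; right; split=> //; rewrite /= /same_order /ltcompat /=.
    by split; split=> h //=; lra.
  left; left; left; split=> //; rewrite /= /same_order /ltcompat /=.
  by split; split=> h //=; lra.
Qed.

Lemma basin_disjoint p q : p != q -> basin p `&` basin q = set0 :> set (R * R * R).
Proof.
move=> pq; apply/seteqP; split=> // z [[_ hp] [_ hq]].
by move: pq; rewrite (cvg_unique _ hp hq) ?eqxx.
Qed.

Lemma measurable_basin q : patterned q -> measurable (basin q).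
Proof.
move=> pq; rewrite basin_E3//; apply: measurableI.
  exact: measurable_E3.
exact: measurable_same_order.
Qed.

Lemma lambda3_basin q : patterned q ->
  lambda3 (basin q) = lambda3 (basin ((1, -1, -1) : R * R * R)).
Proof.
have h12 : lambda3 (basin ((1, -1, -1) : R * R * R)) =
    lambda3 (basin ((-1, 1, -1) : R * R * R)).
  rewrite (basin_coord_perm coord_perm_swap12 patterned1).
  exact: lambda3_swap12 (measurable_basin patterned2).
have h23 : lambda3 (basin ((-1, 1, -1) : R * R * R)) =
    lambda3 (basin ((-1, -1, 1) : R * R * R)).
  rewrite (basin_coord_perm coord_perm_swap23 patterned2).
  exact: lambda3_swap23 (measurable_basin patterned3).
case=> ->; [exact: erefl|exact: esym h12|exact: esym (etrans h12 h23)].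
Qed.

Lemma lambda3_E3 :
  lambda3 (@E3 R) = (3%:E * lambda3 (basin (1, -1, -1)%R))%E.
Proof.
have m1 := measurable_basin patterned1; have m2 := measurable_basin patterned2.
have m3 := measurable_basin patterned3.
have U A B : measurable A -> measurable B -> A `&` B = set0 ->
    lambda3 (A `|` B) = (lambda3 A + lambda3 B)%E :> \bar R.
  by move=> mA mB AB; apply: measureU.
have Et : lambda3 (@E3 R `&` (tie12 `|` tie13 `|` tie23)) = 0%E.
  rewrite /lambda3; apply: (subset_measure0 _ _ (@subIsetr _ _ _) lambda3_ties).
    exact: measurableI measurable_E3 measurable_ties.
  exact: measurable_ties.
have b12 : basin (1, -1, -1) `&` basin (-1, 1, -1) = set0 :> set (R * R * R).
  by apply: basin_disjoint; apply/eqP => -[]; lra.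
have b13 : basin (1, -1, -1) `&` basin (-1, -1, 1) = set0 :> set (R * R * R).
  by apply: basin_disjoint; apply/eqP => -[]; lra.
have b23 : basin (-1, 1, -1) `&` basin (-1, -1, 1) = set0 :> set (R * R * R).
  by apply: basin_disjoint; apply/eqP => -[]; lra.
have m12 := measurableU _ _ m1 m2.
rewrite E3_split (lambda3U0 (measurableU _ _ m12 m3) _ Et); last first.
  exact: measurableI measurable_E3 measurable_ties.
rewrite (U _ _ m12 m3); last by rewrite setIUl b13 b23 setU0.
rewrite (U _ _ m1 m2 b12) (lambda3_basin patterned2) (lambda3_basin patterned3).
by rewrite mule_natl -addeA.
Qed.

End Measure.

Theorem proposition6 (R : realType) :
  (forall p : R * R * R, patterned p ->
    [/\ relatively_open E3nd (basin p),
        measurable (basin p) &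
        forall s : 'S_3, sact s @` basin p = basin (sact s p)]) /\
  (forall p q : R * R * R, patterned p -> patterned q ->
    lambda3 (basin p) = lambda3 (basin q)) /\
  (forall p : R * R * R, patterned p ->
    lambda3 (basin p) = ((1 / 3)%:E * lambda3 E3)%E).
Proof.
split; [|split].
- move=> p pp; split; last 2 first.
  + exact: measurable_basin.
  + move=> s; have cs := sact_coord_perm (R := R) s.
    rewrite [in LHS](basin_coord_perm cs pp) image_preimage//.
    by apply/seteqP; split=> // q _; have [p' <-] := coord_perm_onto cs q; exists p'.
  + by exists [set q | same_order p q]; [exact: open_same_order|exact: basinE].
- by move=> p q pp pq; rewrite (lambda3_basin pp) (lambda3_basin pq).
- move=> p pp; rewrite (lambda3_basin pp) lambda3_E3 muleA -EFinM.
  by rewrite mul1r mulVf ?mul1e// pnatr_eq0.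
Qed.
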